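(* $\mathbf{D}({}^{<\omega}2)\le_{\mathrm T}\mathbf{R}({}^\omega\mathbb{C}_\omega/\mathrm{Fin})\le_{\mathrm T}\mathbf{D}({}^{<\omega}2)\mathbin{;}\mathbf{R}(\mathcal{P}(\omega)/\mathrm{fin})$.
   Context: Order ${}^{<\omega}2$ by: $s<t$ iff ($t\subset s$ and $s(|t|)=0$) or ($s\subset t$ and $t(|s|)=1$) or ($s,t$ incompatible and $s(k)<t(k)$ at their first point of difference $k$), with the order topology (a copy of the rationals). Here $D$ is dense iff every $s$ has an extension in $D$, and $N$ is nowhere dense iff there is a maximal $\subseteq$-antichain $A\subseteq{}^{<\omega}2$ with every element of $N$ below some element of $A$. $\mathbf{D}({}^{<\omega}2)=\langle\mathrm{nwd}({}^{<\omega}2),\perp^*,\mathrm{Dense}({}^{<\omega}2)\rangle$, where $N\perp^*D$ iff $N\cap D$ is finite. $\mathbb{C}_\omega=\mathcal{B}({}^\omega2)/\mathcal{M}$ is the Cohen algebra; ${}^\omega\mathbb{C}_\omega/\mathrm{Fin}$ is the product ${}^\omega\mathbb{C}_\omega$ modulo $\mathrm{Fin}=\{f:\{n:f(n)>\mathbb0\}\text{ finite}\}$. For a Boolean algebra $\mathbb{A}$, $\mathbf{R}(\mathbb{A})=\langle\mathbb{A},R,\mathbb{A}\setminus\{\mathbb0\}\rangle$ with $b\,R\,r$ iff $r\le b$ or $r\wedge b=\mathbb0$. A relational system is a triple $\mathbf{A}=\langle A_-,A,A_+\rangle$ with $A\subseteq A_-\times A_+$. $\mathbf{A}\mathbin{;}\mathbf{B}=\langle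 A_-\times{}^{A_+}B_-,S,A_+\times B_+\rangle$ with $\langle\langle x,f\rangle,\langle a,b\rangle\rangle\in S$ iff $\langle x,a\rangle\in A$ and $\langle f(a),b\rangle\in B$. A generalized Galois–Tukey connection from $\mathbf{A}$ to $\mathbf{B}$ is a pair $\varphi_-\colon A_-\to B_-$, $\varphi_+\colon B_+\to A_+$ with $\langle\varphi_-(a),b\rangle\in B\Rightarrow\langle a,\varphi_+(b)\rangle\in A$; $\mathbf{A}\le_{\mathrm T}\mathbf{B}$ means one exists. *)

(* Defs.v *)
From HB Require Import structures.
From mathcomp Require Import all_boot all_order all_algebra.
From mathcomp Require Import all_classical topology measure cantor.

Set Implicit Arguments.
Unset Strict Implicit.
Unset Printing Implicit Defensive.

Import Order.Theory.

Local Open Scope classical_set_scope.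

Record relsys := RelSys {
  rs_minus : Type;
  rs_plus : Type;
  rs_rel : rs_minus -> rs_plus -> Prop
}.

Definition rs_seq (A B : relsys) : relsys :=
  @RelSys (rs_minus A * (rs_plus A -> rs_minus B)) (rs_plus A * rs_plus B)
    (fun xf ab => rs_rel xf.1 ab.1 /\ rs_rel (xf.2 ab.1) ab.2).

Definition tukey_le (A B : relsys) : Prop :=
  exists (phm : rs_minus A -> rs_minus B) (php : rs_plus B -> rs_plus A),
    forall a b, rs_rel (phm a) b -> rs_rel a (php b).

Section Baire_category.
Variable T : topologicalType.
Implicit Types A N : set T.

Definition nowhere_dense N : Prop := interior (closure N) = set0.

Definition meager A : Prop :=
  exists2 F : nat -> set T, (forall n, nowhere_dense (F n)) & A = \bigcup_n F n.

Lemma sub_nowhere_dense A N : A `<=` N -> nowhere_dense N -> nowhere_dense A.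
Proof.
move=> AN N0; apply/seteqP; split=> // x Ax; rewrite -N0.
by apply: filterS Ax; exact: closureS.
Qed.

Lemma meager0 : meager set0.
Proof.
exists (fun=> set0) => [n|]; last by rewrite bigcup0.
by rewrite /nowhere_dense closure0 interior0.
Qed.

Lemma sub_meager A B : A `<=` B -> meager B -> meager A.
Proof.
move=> AB [F Fn BF]; exists (fun n => F n `&` A) => [n|].
  by apply: sub_nowhere_dense (Fn n) => x [].
by rewrite -setI_bigcupl -BF; apply/esym/setIidr.
Qed.

Lemma meagerU A B : meager A -> meager B -> meager (A `|` B).
Proof.
move=> [F Fn ->] [G Gn ->].
exists (fun n => if odd n then F n./2 else G n./2) => [n|].
  by case: (odd n).
apply/seteqP; split=> [x [[n _ Fx]|[n _ Gx]]|x [n _]].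
- by exists n.*2.+1 => //=; rewrite odd_double /= uphalf_double.
- by exists n.*2 => //=; rewrite odd_double doubleK.
- by case: (odd n) => ?; [left|right]; exists n./2.
Qed.

End Baire_category.

Local Open Scope order_scope.

(* Boolean algebras are the library's ctbDistrLatticeType. *)

Record ideal d (A : ctbDistrLatticeType d) := Ideal {
  ideal_set : set A;
  ideal0 : ideal_set \bot;
  ideal_le : forall a b, a <= b -> ideal_set b -> ideal_set a;
  idealU : forall a b, ideal_set a -> ideal_set b -> ideal_set (a `|` b)
}.

Section quotient_algebra.
Context d (A : ctbDistrLatticeType d) (I : ideal A).
Implicit Types a b c : A.

Definition ideal_eqv : rel A :=
  fun a b => `[< ideal_set I ((a `\` b) `|` (b `\` a)) >].

Lemma ideal_eqvP a b :
  reflect (exists2 i, ideal_set I i & a `|` i = b `|` i) (ideal_eqv a b).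
Proof.
rewrite /ideal_eqv; apply: (iffP (asboolP _)) => [Iab|[i Ii abi]].
  exists ((a `\` b) `|` (b `\` a)) => //.
  have E x y : x `|` ((x `\` y) `|` (y `\` x)) = x `|` y.
    rewrite joinCA diffKU; apply/join_idPr.
    exact: le_trans (leBx _ _) (leUl _ _).
  by rewrite E [in RHS](joinC (a `\` b)) E joinC.
apply: ideal_le Ii; rewrite leUx !leBLR; apply/andP; split.
  by rewrite -abi leUl.
by rewrite abi leUl.
Qed.

Lemma ideal_eqv_is_equiv : equiv_class_of ideal_eqv.
Proof.
split=> [a|a b|b a c].
- by apply/ideal_eqvP; exists \bot => //; exact: ideal0.
- by rewrite /ideal_eqv joinC.
- move=> /ideal_eqvP[i Ii abi] /ideal_eqvP[j Ij bcj].
  apply/ideal_eqvP; exists (i `|` j); first exact: idealU.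
  by rewrite joinA abi -joinA (joinC i) joinA bcj -joinA (joinC j).
Qed.

Canonical ideal_equiv_rel := EquivRelPack ideal_eqv_is_equiv.

Definition ba_quot : Type := {eq_quot ideal_equiv_rel}%qT.
HB.instance Definition _ := Choice.on ba_quot.
HB.instance Definition _ := EqQuotient.on ba_quot.

Local Notation pi := (\pi_ba_quot)%qT.

Lemma ba_quot_eqP a b :
  pi a = pi b <-> exists2 i, ideal_set I i & a `|` i = b `|` i.
Proof.
split=> [/eqmodP/ideal_eqvP //|h].
by apply/eqmodP/ideal_eqvP.
Qed.

Definition quot_meet (x y : ba_quot) : ba_quot := pi (repr x `&` repr y).
Definition quot_join (x y : ba_quot) : ba_quot := pi (repr x `|` repr y).
Definition quot_compl (x : ba_quot) : ba_quot := pi (~` repr x).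
Definition quot_le (x y : ba_quot) : bool := quot_meet x y == x.
Definition quot_lt (x y : ba_quot) : bool := (y != x) && quot_le x y.

Lemma repr_piP a : exists2 i, ideal_set I i & repr (pi a) `|` i = a `|` i.
Proof. by apply/ba_quot_eqP; rewrite reprK. Qed.

Lemma quot_meetE a b : quot_meet (pi a) (pi b) = pi (a `&` b).
Proof.
have [i Ii ai] := repr_piP a; have [j Ij bj] := repr_piP b.
apply/ba_quot_eqP; exists (i `|` j); first exact: idealU.
by rewrite !joinIl !(joinA _ i j) ai ![_ `|` i `|` j]joinAC bj.
Qed.

Lemma quot_joinE a b : quot_join (pi a) (pi b) = pi (a `|` b).
Proof.
have [i Ii ai] := repr_piP a; have [j Ij bj] := repr_piP b.
apply/ba_quot_eqP; exists (i `|` j); first exact: idealU.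
by rewrite !(joinACA _ _ i) ai bj.
Qed.

Lemma quot_complE a : quot_compl (pi a) = pi (~` a).
Proof.
have [i Ii ai] := repr_piP a.
apply/ba_quot_eqP; exists i => //.
have E (c : A) : ~` c `|` i = ~` (c `|` i) `|` i.
  by rewrite complU joinIl joinCx meetx1.
by rewrite E ai -E.
Qed.

Lemma quot_ind (P : ba_quot -> Prop) : (forall a, P (pi a)) -> forall x, P x.
Proof. by move=> h x; rewrite -[x]reprK. Qed.

Let quotE := (quot_meetE, quot_joinE, quot_complE).

Lemma quot_leE x y : quot_le x y = (quot_meet x y == x). Proof. by []. Qed.
Lemma quot_ltE x y : quot_lt x y = (y != x) && quot_le x y. Proof. by []. Qed.
Lemma quot_meetC : commutative quot_meet.
Proof. by elim/quot_ind=> a; elim/quot_ind=> b; rewrite !quotE meetC. Qed.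
Lemma quot_joinC : commutative quot_join.
Proof. by elim/quot_ind=> a; elim/quot_ind=> b; rewrite !quotE joinC. Qed.
Lemma quot_meetA : associative quot_meet.
Proof.
elim/quot_ind=> a; elim/quot_ind=> b; elim/quot_ind=> c.
by rewrite !quotE meetA.
Qed.
Lemma quot_joinA : associative quot_join.
Proof.
elim/quot_ind=> a; elim/quot_ind=> b; elim/quot_ind=> c.
by rewrite !quotE joinA.
Qed.
Lemma quot_joinKI y x : quot_meet x (quot_join x y) = x.
Proof.
by elim/quot_ind: x => a; elim/quot_ind: y => b; rewrite !quotE joinKI.
Qed.
Lemma quot_meetKU y x : quot_join x (quot_meet x y) = x.
Proof.
by elim/quot_ind: x => a; elim/quot_ind: y => b; rewrite !quotE meetKU.
Qed.
Lemma quot_meetUl : left_distributive quot_meet quot_join.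
Proof.
elim/quot_ind=> a; elim/quot_ind=> b; elim/quot_ind=> c.
by rewrite !quotE meetUl.
Qed.
Lemma quot_meetxx : idempotent_op quot_meet.
Proof. by elim/quot_ind=> a; rewrite !quotE meetxx. Qed.

HB.instance Definition _ := Order.isMeetJoinDistrLattice.Build d ba_quot
  quot_leE quot_ltE quot_meetC quot_joinC quot_meetA quot_joinA
  quot_joinKI quot_meetKU quot_meetUl quot_meetxx.

Lemma quot_le0x (x : ba_quot) : pi \bot <= x.
Proof.
by elim/quot_ind: x => a; apply/eqP; rewrite quotE meet0x.
Qed.
Lemma quot_lex1 (x : ba_quot) : x <= pi \top.
Proof.
by elim/quot_ind: x => a; apply/eqP; rewrite quotE meetx1.
Qed.

HB.instance Definition _ := Order.hasBottom.Build d ba_quot quot_le0x.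
HB.instance Definition _ := Order.hasTop.Build d ba_quot quot_lex1.

Lemma quot_joinxC (x : ba_quot) : x `|` quot_compl x = \top.
Proof. by elim/quot_ind: x => a; rewrite quotE [LHS]quotE joinxC. Qed.
Lemma quot_meetxC (x : ba_quot) : x `&` quot_compl x = \bot.
Proof. by elim/quot_ind: x => a; rewrite quotE [LHS]quotE meetxC. Qed.

HB.instance Definition _ := Order.TBDistrLattice_hasComplement.Build d ba_quot
  quot_joinxC quot_meetxC.

Lemma quot_pi_le a b : pi a <= pi b <-> ideal_set I (a `\` b).
Proof.
rewrite leEmeet; split=> [/eqP|Iab].
  rewrite [_ `&` _]quot_meetE => /ba_quot_eqP[i Ii abi].
  apply: ideal_le Ii; rewrite leBLR.
  apply: le_trans (leUl a i) _; rewrite -abi; apply: leU2 => //; exact: leIr.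
apply/eqP; rewrite [LHS]quot_meetE; apply/ba_quot_eqP.
exists (a `\` b) => //; rewrite joinIB; apply/esym/join_idPl; exact: leBx.
Qed.

End quotient_algebra.

Section power_algebra.
Context d (A : ctbDistrLatticeType d).

Definition ba_power : Type := nat -> A.
HB.instance Definition _ := Choice.copy ba_power (nat -> A).
Implicit Types f g h : ba_power.

Definition power_le f g : bool := `[< forall n, f n <= g n >].
Definition power_lt f g : bool := (g != f) && power_le f g.
Definition power_meet f g : ba_power := fun n => f n `&` g n.
Definition power_join f g : ba_power := fun n => f n `|` g n.
Definition power_compl f : ba_power := fun n => ~` f n.

Lemma power_leE f g : power_le f g = (power_meet f g == f).
Proof.
apply/asboolP/eqP => [fg|<- n]; last exact: leIr.
by apply/funext => n; exact/meet_idPl.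
Qed.
Lemma power_ltE f g : power_lt f g = (g != f) && power_le f g.
Proof. by []. Qed.
Lemma power_meetC : commutative power_meet.
Proof. by move=> f g; apply/funext => n; exact: meetC. Qed.
Lemma power_joinC : commutative power_join.
Proof. by move=> f g; apply/funext => n; exact: joinC. Qed.
Lemma power_meetA : associative power_meet.
Proof. by move=> f g h; apply/funext => n; exact: meetA. Qed.
Lemma power_joinA : associative power_join.
Proof. by move=> f g h; apply/funext => n; exact: joinA. Qed.
Lemma power_joinKI g f : power_meet f (power_join f g) = f.
Proof. by apply/funext => n; exact: joinKI. Qed.
Lemma power_meetKU g f : power_join f (power_meet f g) = f.
Proof. by apply/funext => n; exact: meetKU. Qed.
Lemma power_meetUl : left_distributive power_meet power_join.
Proof. by move=> f g h; apply/funext => n; exact: meetUl. Qed.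
Lemma power_meetxx : idempotent_op power_meet.
Proof. by move=> f; apply/funext => n; exact: meetxx. Qed.

HB.instance Definition _ := Order.isMeetJoinDistrLattice.Build d ba_power
  power_leE power_ltE power_meetC power_joinC power_meetA power_joinA
  power_joinKI power_meetKU power_meetUl power_meetxx.

Lemma power_le0x f : ((fun=> \bot) : ba_power) <= f.
Proof. by apply/asboolP => n; exact: le0x. Qed.
Lemma power_lex1 f : f <= ((fun=> \top) : ba_power).
Proof. by apply/asboolP => n; exact: lex1. Qed.

HB.instance Definition _ := Order.hasBottom.Build d ba_power power_le0x.
HB.instance Definition _ := Order.hasTop.Build d ba_power power_lex1.

Lemma power_joinxC f : f `|` power_compl f = \top.
Proof. by apply/funext => n; exact: joinxC. Qed.
Lemma power_meetxC f : f `&` power_compl f = \bot.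
Proof. by apply/funext => n; exact: meetxC. Qed.

HB.instance Definition _ := Order.TBDistrLattice_hasComplement.Build d ba_power
  power_joinxC power_meetxC.

Definition power_fin : set ba_power :=
  [set f : ba_power | finite_set [set n | \bot < f n]].

Lemma power_fin0 : power_fin \bot.
Proof.
rewrite /power_fin /= (_ : [set _ | _] = set0) //.
by apply/seteqP; split=> n //=; rewrite ltxx.
Qed.
Lemma power_fin_le f g : f <= g -> power_fin g -> power_fin f.
Proof.
move=> /asboolP fg; apply: sub_finite_set => n /= f0.
exact: lt_le_trans f0 (fg n).
Qed.
Lemma power_finU f g : power_fin f -> power_fin g -> power_fin (f `|` g).
Proof.
move=> ff fg; apply: (@sub_finite_set _ _
  ([set n | \bot < f n] `|` [set n | \bot < g n])%classic).
  move=> n /=; rewrite !lt0x => fgn; apply/orP; rewrite -negb_and.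
  apply: contra fgn => /andP[/eqP fn /eqP gn]; apply/eqP.
  by transitivity (f n `|` g n) => //; rewrite fn gn joinxx.
by rewrite finite_setU.
Qed.

Definition power_fin_ideal : ideal ba_power :=
  Ideal power_fin0 power_fin_le power_finU.

End power_algebra.

Section Borel_algebra.
Variable T : topologicalType.

Definition borel_pred : pred (set T) := fun B => `[< <<s @open T >> B >].
Definition borel : Type := {B : set T | borel_pred B}.
HB.instance Definition _ := SubChoice.on borel.
Implicit Types B C D : borel.

Definition mk_borel (B : set T) (bB : borel_pred B) : borel :=
  exist (fun X : set T => borel_pred X) B bB.

Lemma borelC (B : set T) : borel_pred B -> borel_pred (~` B)%classic.
Proof.
by move=> /asboolP bB; apply/asboolP; rewrite -setTD; exact: sigma_algebraCD.
Qed.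
Lemma borelU (B C : set T) :
  borel_pred B -> borel_pred C -> borel_pred (B `|` C)%classic.
Proof.
move=> /asboolP bB /asboolP bC; apply/asboolP; rewrite -bigcup2E.
by apply: sigma_algebra_bigcup => -[|[|n]] //=; exact: sigma_algebra0.
Qed.
Lemma borelI (B C : set T) :
  borel_pred B -> borel_pred C -> borel_pred (B `&` C)%classic.
Proof.
move=> bB bC; rewrite -(setCK (B `&` C)%classic) setCI.
by apply/borelC/borelU; exact: borelC.
Qed.
Lemma borel0 : borel_pred set0.
Proof. by apply/asboolP; exact: sigma_algebra0. Qed.
Lemma borelT : borel_pred setT.
Proof. by rewrite -setC0; exact/borelC/borel0. Qed.

Definition borel_le B C : bool := val B <= val C.
Definition borel_lt B C : bool := (C != B) && borel_le B C.
Definition borel_meet B C : borel := mk_borel (borelI (valP B) (valP C)).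
Definition borel_join B C : borel := mk_borel (borelU (valP B) (valP C)).
Definition borel_compl B : borel := mk_borel (borelC (valP B)).

Lemma borel_leE B C : borel_le B C = (borel_meet B C == B).
Proof. by rewrite -val_eqE /= /borel_le leEmeet. Qed.
Lemma borel_ltE B C : borel_lt B C = (C != B) && borel_le B C.
Proof. by []. Qed.
Lemma borel_meetC : commutative borel_meet.
Proof. by move=> B C; apply/val_inj; exact: meetC. Qed.
Lemma borel_joinC : commutative borel_join.
Proof. by move=> B C; apply/val_inj; exact: joinC. Qed.
Lemma borel_meetA : associative borel_meet.
Proof. by move=> B C D; apply/val_inj; exact: meetA. Qed.
Lemma borel_joinA : associative borel_join.
Proof. by move=> B C D; apply/val_inj; exact: joinA. Qed.
Lemma borel_joinKI C B : borel_meet B (borel_join B C) = B.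
Proof. by apply/val_inj; exact: joinKI. Qed.
Lemma borel_meetKU C B : borel_join B (borel_meet B C) = B.
Proof. by apply/val_inj; exact: meetKU. Qed.
Lemma borel_meetUl : left_distributive borel_meet borel_join.
Proof. by move=> B C D; apply/val_inj; exact: meetUl. Qed.
Lemma borel_meetxx : idempotent_op borel_meet.
Proof. by move=> B; apply/val_inj; exact: meetxx. Qed.

HB.instance Definition _ := Order.isMeetJoinDistrLattice.Build set_display borel
  borel_leE borel_ltE borel_meetC borel_joinC borel_meetA borel_joinA
  borel_joinKI borel_meetKU borel_meetUl borel_meetxx.

Lemma borel_le0x B : mk_borel borel0 <= B.
Proof. exact: (@le0x _ (set T)). Qed.
Lemma borel_lex1 B : B <= mk_borel borelT.
Proof. exact: (@lex1 _ (set T)). Qed.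

HB.instance Definition _ := Order.hasBottom.Build set_display borel borel_le0x.
HB.instance Definition _ := Order.hasTop.Build set_display borel borel_lex1.

Lemma borel_joinxC B : B `|` borel_compl B = \top.
Proof. by apply/val_inj; exact: joinxC. Qed.
Lemma borel_meetxC B : B `&` borel_compl B = \bot.
Proof. by apply/val_inj; exact: meetxC. Qed.

HB.instance Definition _ := Order.TBDistrLattice_hasComplement.Build set_display
  borel borel_joinxC borel_meetxC.

Definition borel_meager : set borel := [set B | meager (val B)].

Lemma borel_meager0 : borel_meager \bot. Proof. exact: meager0. Qed.
Lemma borel_meager_le B C : B <= C -> borel_meager C -> borel_meager B.
Proof. by move=> BC; apply: sub_meager; exact/subsetPset. Qed.
Lemma borel_meagerU B C :
  borel_meager B -> borel_meager C -> borel_meager (B `|` C).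
Proof. exact: meagerU. Qed.

Definition borel_meager_ideal : ideal borel :=
  Ideal borel_meager0 borel_meager_le borel_meagerU.

End Borel_algebra.

Definition cohen_algebra := ba_quot (borel_meager_ideal cantor_space).
HB.instance Definition _ := Order.CTBDistrLattice.on cohen_algebra.

Definition cohen_power_mod_Fin := ba_quot (power_fin_ideal cohen_algebra).
HB.instance Definition _ := Order.CTBDistrLattice.on cohen_power_mod_Fin.

Lemma finite_set_le T (A B : set T) : A <= B -> finite_set B -> finite_set A.
Proof. by move=> /subsetPset; exact: sub_finite_set. Qed.
Lemma finite_set_join T (A B : set T) :
  finite_set A -> finite_set B -> finite_set (A `|` B)%classic.
Proof. by move=> fA fB; rewrite finite_setU. Qed.

Definition fin_ideal : ideal (set nat) :=
  Ideal (finite_set0 nat) (@finite_set_le nat) (@finite_set_join nat).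

Definition Pomega_mod_fin := ba_quot fin_ideal.
HB.instance Definition _ := Order.CTBDistrLattice.on Pomega_mod_fin.

Definition reaping_sys d (A : ctbDistrLatticeType d) : relsys :=
  @RelSys A {r : A | r != \bot}
    (fun b r => val r <= b \/ val r `&` b = \bot).

Definition bstr : Type := seq bool.
HB.instance Definition _ := Countable.on bstr.

Definition bstr_lt (s t : bstr) : bool :=
  [|| [&& prefix t s, t != s & nth false s (size t) == false],
      [&& prefix s t, s != t & nth false t (size s) == true] |
      [&& ~~ prefix s t, ~~ prefix t s &
        [exists k : 'I_(minn (size s) (size t)),
          [&& take k s == take k t, nth false s k == false &
              nth false t k == true]]]].

Definition bstr_le (s t : bstr) : bool := (s == t) || bstr_lt s t.

Fixpoint bstr_ltr (s t : seq bool) : bool :=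
  match s, t with
  | [::], [::] => false
  | [::], b :: _ => b
  | a :: _, [::] => ~~ a
  | a :: s', b :: t' => if a == b then bstr_ltr s' t' else b
  end.

Lemma bstr_ltrE s t : bstr_lt s t = bstr_ltr s t.
Proof.
have E n (P : pred nat) : [exists k : 'I_n, P k] = has P (iota 0 n).
  apply/existsP/hasP => [[k Pk]|[k]].
    by exists (val k) => //; rewrite mem_iota /= ltn_ord.
  by rewrite mem_iota /= add0n => kn Pk; exists (Ordinal kn).
pose P (s t : seq bool) k := [&& take k s == take k t, nth false s k == false &
  nth false t k == true].
have {}E u v : bstr_lt u v =
    [|| [&& prefix v u, v != u & nth false u (size v) == false],
      [&& prefix u v, u != v & nth false v (size u) == true] |
      [&& ~~ prefix u v, ~~ prefix v u &
        has (P u v) (iota 0 (minn (size u) (size v)))]].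
  by rewrite -(E _ (P u v)).
elim: s t => [|a s IH] [|b t] //=.
- by case: b.
- by case: a.
rewrite -IH !E /= minnSS.
rewrite -[iota 0 _.+1]/(0%N :: iota (1 + 0) (minn (size s) (size t))) iotaDl.
rewrite /= has_map {1}/P /= !eqseq_cons [b == a]eq_sym.
have [<-|ab] := eqVneq a b => /=.
  rewrite (_ : (a == false) && (a == true) = false); last by case: a.
  by congr [|| _, _ | [&& _, _ & _]]; apply: eq_has => k;
    rewrite /P /= eqseq_cons eqxx.
rewrite (_ : has _ _ = false); last first.
  by apply/hasPn => k _; rewrite /P /= eqseq_cons (negbTE ab).
by case: a b ab => [] [].
Qed.

Lemma bstr_lt_irr : irreflexive bstr_lt.
Proof. by move=> s; rewrite bstr_ltrE; elim: s => //= a s; rewrite eqxx. Qed.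

Lemma bstr_lt_trans : transitive bstr_lt.
Proof.
move=> t s u; rewrite !bstr_ltrE.
by elim: s t u => [|[] s IH] [|[] t] [|[] u] //=; exact: IH.
Qed.

Lemma bstr_lt_total s t : s != t -> bstr_lt s t || bstr_lt t s.
Proof.
rewrite !bstr_ltrE.
by elim: s t => [|[] s IH] [|[] t] //=; rewrite eqseq_cons => /IH.
Qed.

Fact bstr_display : Order.disp_t. Proof. exact: Order.Disp tt tt. Qed.

HB.instance Definition _ := Order.LtOrder.Build bstr_display bstr
  (fun _ _ => erefl) (fun _ _ => erefl) (fun _ _ => erefl)
  bstr_lt_irr bstr_lt_trans bstr_lt_total.

(* Dense and nowhere dense refer to the order topology; dense_bstrP and
   nowhere_dense_bstrP below give the descriptions by end-extension. *)
Definition bstr_space := order_topology bstr.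
HB.instance Definition _ := OrderTopological.on bstr_space.

Section bstr_topology.
Implicit Types (s t u x : bstr) (B N : set bstr_space).

Let ext s : set bstr_space := [set t : bstr | prefix s t].

Lemma bstr_lt_catr u t w : ~~ prefix t u -> bstr_lt u (t ++ w) = bstr_lt u t.
Proof.
rewrite !bstr_ltrE; elim: t u => [|a t IH] [|c u] //= ntu.
by have [ca|//] := eqVneq c a; apply: IH; move: ntu; rewrite ca eqxx.
Qed.

Lemma bstr_lt_catl u t w : ~~ prefix t u -> bstr_lt (t ++ w) u = bstr_lt t u.
Proof.
rewrite !bstr_ltrE; elim: t u => [|a t IH] [|c u] //= ntu.
by have [ca|//] := eqVneq a c; apply: IH; move: ntu; rewrite ca eqxx.
Qed.

Lemma bstr_lt_cat x u v : bstr_lt (x ++ u) (x ++ v) = bstr_lt u v.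
Proof. by rewrite !bstr_ltrE; elim: x => //= a x ->; rewrite eqxx. Qed.

Lemma ext_nbhs s : nbhs (s : bstr_space) (ext s).
Proof.
rewrite itv_nbhsE /=.
exists (Interval (BRight (s ++ [:: false] : bstr_space))
                 (BLeft (s ++ [:: true]))).
  split; first by apply/orP; right.
  rewrite in_itv /=; apply/andP; split; rewrite -[_ < _]/(bstr_lt _ _).
    by rewrite -[X in bstr_lt _ X]cats0 bstr_lt_cat.
  by rewrite -[X in bstr_lt X _]cats0 bstr_lt_cat.
move=> t /=; rewrite in_itv /= => /andP[]; rewrite -![_ < _]/(bstr_lt _ _).
rewrite /ext /=; case: (boolP (prefix s t)) => // nst.
rewrite bstr_lt_catl // bstr_lt_catr // => st /(bstr_lt_trans st).
by rewrite bstr_lt_irr.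
Qed.

Lemma ext_open s : open (ext s).
Proof.
rewrite openE => t st; apply: filterS (ext_nbhs t) => u /= tu.
exact: prefix_trans st tu.
Qed.

Let descend x n : bstr := x ++ true :: nseq n false.

Let descend_gt x n w : bstr_lt x (descend x n ++ w).
Proof. by rewrite -{1}[x]cats0 -catA bstr_lt_cat bstr_ltrE. Qed.

Let descend_lt x r n w : (size r < n)%N -> bstr_lt x r ->
  bstr_lt (descend x n ++ w) r.
Proof.
rewrite -catA; elim: x r => [|a x IH] [|b r] //; rewrite !bstr_ltrE /=.
  case: b => // rn _; elim: r n {rn}(ltnW rn) => [|[] r IH] [|n] //= rn.
  exact: IH.
by case: eqP => // _ rn xr; rewrite -bstr_ltrE IH ?bstr_ltrE // ltnW.
Qed.

Let lt_descend x l n w : bstr_lt l x -> bstr_lt l (descend x n ++ w).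
Proof. by move=> lx; apply: bstr_lt_trans (descend_gt x n w). Qed.

Lemma nbhs_ext x B : nbhs (x : bstr_space) B -> exists s, ext s `<=` B.
Proof.
rewrite itv_nbhsE => -[[l r] /= [oi xi] iB].
have [n nP] : exists n,
    forall w, (descend x n ++ w : bstr_space) \in Interval l r.
  case: l r oi xi {iB} => [[] l|[]] [[] r|[]] // _; rewrite ?in_itv /=.
  - move=> /andP[lx xr]; exists (size r).+1 => w; rewrite in_itv /=.
    by apply/andP; split; [exact: lt_descend|exact: descend_lt].
  - rewrite andbT => lx; exists 0%N => w.
    by rewrite in_itv /= andbT; exact: lt_descend.
  - by move=> xr; exists (size r).+1 => w; rewrite in_itv /=; exact: descend_lt.
  - by exists 0%N.
exists (descend x n) => t /= /prefixP[w ->].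
by apply: iB; exact: nP.
Qed.

Lemma dense_bstrP (D : set bstr_space) :
  dense D <-> forall s, exists2 t : bstr, prefix s t & D t.
Proof.
split=> [dD s|dD O [x Ox] oO].
  have [|t [st Dt]] := dD (ext s) _ (ext_open s); last by exists t.
  by exists s; exact: prefix_refl.
have [|s sO] := @nbhs_ext x O; first by move: oO; rewrite openE; exact.
by have [t st Dt] := dD s; exists t; split=> //; exact: sO.
Qed.

Definition bstr_antichain (A : set bstr) : Prop :=
  forall s t, A s -> A t -> prefix s t -> s = t.

Definition bstr_max_antichain (A : set bstr) : Prop :=
  bstr_antichain A /\ forall B, bstr_antichain B -> A `<=` B -> B = A.

Lemma max_antichain_compat (A : set bstr) s : bstr_max_antichain A ->
  exists2 a, A a & prefix s a || prefix a s.
Proof.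
move=> [aA mA]; apply: contrapT => h.
have nc a : A a -> ~~ prefix s a && ~~ prefix a s.
  by move=> Aa; rewrite -negb_or; apply/negP => sa; apply: h; exists a.
have sA : A s.
  rewrite -(mA (A `|` [set s])%classic); [by right| |by move=> ?; left].
  move=> u v [Au|->] [Av|->] //; first exact: aA.
    by move=> us; case/andP: (nc _ Au) => _; rewrite us.
  by move=> sv; case/andP: (nc _ Av); rewrite sv.
by case/andP: (nc _ sA); rewrite prefix_refl.
Qed.

Lemma nowhere_dense_extP N : nowhere_dense N <->
  forall s, exists2 t : bstr, prefix s t & forall u : bstr, prefix t u -> ~ N u.
Proof.
split=> [N0 s|h].
  have : ~ (ext s `<=` closure N).
    move=> sN; have : interior (closure N) (s : bstr_space).
      by apply: filterS sN _; exact: ext_nbhs.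
    by rewrite N0.
  move=> /existsNP[x /not_implyP[sx]] /existsNP[B /not_implyP[xB NB]].
  have [|t tP] := @nbhs_ext x (B `&` ext s)%classic.
    apply: filterI => //.
    by move: (ext_open s); rewrite openE; exact.
  exists t; first by have [] := tP t (prefix_refl t).
  by move=> u tu Nu; apply: NB; exists u; split=> //; have [] := tP u tu.
apply/seteqP; split=> // x /nbhs_ext[s sN].
have [t st tN] := h s.
by have [u [Nu /tN]] := sN t st _ (ext_nbhs t).
Qed.

Lemma nowhere_dense_bstrP N : nowhere_dense N <->
  exists2 A : set bstr, bstr_max_antichain A &
    forall s : bstr, N s -> exists2 a, A a & prefix s a.
Proof.
rewrite nowhere_dense_extP; split=> [h|[A mA NA] s]; last first.
  have [a Aa sa] := max_antichain_compat s mA.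
  have [t st at_] : exists2 t, prefix s t & prefix a t.
    by case/orP: sa => ?; [exists a|exists s] => //; exact: prefix_refl.
  exists (t ++ [:: true]); first exact: prefix_trans st (prefix_prefix _ _).
  move=> u tu /NA[b Ab ub].
  have tu' : prefix t u by exact: prefix_trans (prefix_prefix _ _) tu.
  have au' : prefix a u by exact: prefix_trans at_ tu'.
  have ab : a = b by apply: mA.1 => //; exact: prefix_trans au' ub.
  have := size_prefix tu; have := size_prefix ub; have := size_prefix at_.
  rewrite ab size_cat addn1 => bt ub' tu''.
  by have := leq_trans (leq_trans tu'' ub') bt; rewrite ltnn.
pose P (t : bstr) := `[< forall u : bstr, prefix t u -> ~ N u >].
pose A : set bstr := [set t | P t /\ forall s, prefix s t -> P s -> s = t].
have aA : bstr_antichain A by move=> s t [Ps _] [_ mt] st; exact: mt.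
have cA s : exists2 a, A a & prefix s a || prefix a s.
  have [t st /asboolP Pt] := h s.
  have exn : exists n, P (take n t) by exists (size t); rewrite take_size.
  pose n := ex_minn exn.
  exists (take n t).
    rewrite /n; case: ex_minnP => k Pk mk; split=> // v vt Pv.
    have vE : take (size v) t = v.
      by apply/eqP; rewrite -prefixE; exact: prefix_trans vt (prefix_take _ _).
    have kv : (k <= size v)%N by apply: mk; rewrite vE.
    have tkv : (size (take k t) <= size v)%N.
      by rewrite size_take_min geq_min kv.
    by move: vt; rewrite prefixE take_oversize // => /eqP.
  move: st; rewrite prefixE => /eqP <-.
  have [le_sn|/ltnW le_ns] := leqP (size s) n.
    by rewrite -(take_takel _ le_sn) prefix_take.
  by rewrite -(take_takel _ le_ns) prefix_take orbT.
exists A.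
  split=> // B aB AB; apply/seteqP; split=> // s Bs.
  have [a Aa /orP[sa|sa]] := cA s; first by rewrite (aB _ _ Bs (AB _ Aa) sa).
  by rewrite -(aB _ _ (AB _ Aa) Bs sa).
move=> s Ns; have [a Aa /orP[sa|sa]] := cA s; first by exists a.
by have [/asboolP/(_ _ sa)] := Aa.
Qed.

End bstr_topology.

Definition dense_sys : relsys :=
  @RelSys {N : set bstr_space | nowhere_dense N} {D : set bstr_space | dense D}
    (fun N D => finite_set (sval N `&` sval D)%classic).

(* Main.v *)
Require Import Defs.
From HB Require Import structures.
From mathcomp Require Import all_boot all_order all_algebra.
From mathcomp Require Import all_classical topology measure cantor.

Set Implicit Arguments.
Unset Strict Implicit.
Unset Printing Implicit Defensive.

Import Order.Theory.

Local Open Scope classical_set_scope.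

(* For a string [t] let [<t>] be the class of its cylinder in the Cohen algebra;
   say that [t] decides [c] if [<t>] is below [c] or disjoint from [c].  Borel
   sets have the Baire property, so the classes [<t>] are dense in the Cohen
   algebra and every [c] is decided by densely many strings.

   Left inequality: if every element of [N] is below some element of an antichain
   [A], then the union of the cylinders of [a1], for [a] in [A], is decided by no
   element of [N].  With [e] an enumeration of the strings, apply this to
   [N_k = {t : e_j t is in N for some j < k}] and send [N] to the resulting
   sequence.  A nonzero [r] with [<t_k> <= r_k] is sent to the set of all [e_j t_k]
   with [j < k] and [r_k > 0], which is dense because [r_k > 0] infinitely often.

   Right inequality: [f] is sent to the set of the strings [0^n 1 s] such that [s]
   does not decide [f_n].  If a dense [D] almost avoids it and [0^n 1 s_n] is in
   [D], then [s_n] decides [f_n] for almost all [n], and a set [X] unsplit by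
   [{n : <s_n> <= f_n}] gives the sequence that is [<s_n>] on [X] and [0]
   elsewhere. *)

(** * Cylinders and nowhere dense sets in the Cantor space *)

Definition cyl (s : bstr) : set cantor_space :=
  [set x : cantor_space | forall i, (i < size s)%N -> x i = nth false s i].

Definition zero_ext (s : bstr) : cantor_space := nth false s.

Lemma cyl_zero_ext s : cyl s (zero_ext s).
Proof. by []. Qed.

Lemma cyl_mkseq (x : cantor_space) n : cyl (mkseq x n) x.
Proof. by move=> i; rewrite size_mkseq => ilt; rewrite nth_mkseq. Qed.

Lemma sub_cyl s t : prefix s t -> cyl t `<=` cyl s.
Proof.
move=> /prefixP[u ->] x tx i ilt; rewrite tx ?nth_cat ?ilt //.
by rewrite size_cat ltn_addr.
Qed.

Lemma cyl_prefix s t x :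
  cyl s x -> cyl t x -> (size s <= size t)%N -> prefix s t.
Proof.
move=> sx tx st; rewrite prefixE; apply/eqP.
apply: (@eq_from_nth _ false); rewrite size_takel // => i ilt.
by rewrite nth_take // -sx // -tx // (leq_trans ilt).
Qed.

Lemma cyl_compat s t x : cyl s x -> cyl t x ->
  exists u, [/\ prefix s u, prefix t u & cyl u x].
Proof.
move=> sx tx; have [st|/ltnW ts] := leqP (size s) (size t).
  by exists t; split=> //; [exact: cyl_prefix sx tx st|exact: prefix_refl].
by exists s; split=> //; [exact: prefix_refl|exact: cyl_prefix tx sx ts].
Qed.

Lemma nbhs_cyl s (x : cantor_space) : cyl s x -> nbhs x (cyl s).
Proof.
move=> sx.
(* Induction on the length intersects one coordinate neighbourhood at a time. *)
suff : forall n,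
    nbhs x [set y : cantor_space | forall i, (i < n)%N -> y i = x i].
  by move=> /(_ (size s)); apply: filterS => y yx i ilt; rewrite yx ?sx.
elim=> [|n IH]; first by apply: filterS filterT.
have xn : nbhs x (proj n @^-1` [set x n]).
  by apply: (@proj_continuous nat (fun=> bool) n x); exact: discrete_set1.
apply: filterS (filterI IH xn) => y [yx yn] i.
by rewrite ltnS leq_eqVlt => /predU1P[->|/yx].
Qed.

(** Otherwise each cylinder [mkseq x n] contains a point outside [A]; these points converge to [x]
    coordinatewise, hence eventually enter [A]. *)
Lemma nbhs_sub_cyl (x : cantor_space) (A : set cantor_space) :
  nbhs x A -> exists n, cyl (mkseq x n) `<=` A.
Proof.
move=> xA; apply: contrapT => h.
have /choice[y yP] n : exists y, cyl (mkseq x n) y /\ ~ A y.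
  apply: contrapT => hn; apply: h; exists n => z zx.
  by apply: contrapT => Az; apply: hn; exists z.
have ycvg : y @ \oo --> x.
  apply/cvg_sup => N U [V] [[W] oW <-] WfN WU.
  apply: (filterS WU); rewrite nbhs_simpl; exists N.+1 => // i /= Ni.
  by have [yx _] := yP i; rewrite yx ?size_mkseq // nth_mkseq.
have /ycvg := xA; rewrite nbhs_simpl => -[N _ An].
by have [_] := yP N; apply; apply: An => /=.
Qed.

Lemma nowhere_dense_cylP (F : set cantor_space) : nowhere_dense F <->
  forall s, exists2 t, prefix s t & cyl t `&` F = set0.
Proof.
split=> [F0 s|h].
  have : ~ (cyl s `<=` closure F).
    move=> sF; have : interior (closure F) (zero_ext s).
      by apply: filterS sF _; exact/nbhs_cyl/cyl_zero_ext.
    by rewrite F0.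
  move=> /existsNP[x /not_implyP[sx]] /existsNP[B /not_implyP[xB NB]].
  have [n nB] := nbhs_sub_cyl xB.
  have [t [st nt tx]] := cyl_compat sx (@cyl_mkseq x n).
  exists t => //; apply/seteqP; split=> // y [ty Fy].
  by apply: NB; exists y; split=> //; exact/nB/(sub_cyl nt).
apply/seteqP; split=> // x /nbhs_sub_cyl[n nF].
have [t nt tF] := h (mkseq x n).
have /nF/(_ (cyl t)) := sub_cyl nt (@cyl_zero_ext t).
move=> /(_ (nbhs_cyl (@cyl_zero_ext t)))[y [Fy ty]].
by have : (cyl t `&` F) y by []; rewrite tF.
Qed.

Lemma cyl_open s : open (cyl s).
Proof. by rewrite openE => x sx; exact: nbhs_cyl. Qed.

(* A Baire category argument: the generic point is read off a chain of strings
   avoiding the nowhere dense sets one after the other. *)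
Lemma cyl_not_meager s : ~ meager (cyl s).
Proof.
move=> [F nwdF sF].
have /choice[ext extP] (nt : nat * bstr) :
    exists u, prefix nt.2 u /\ cyl u `&` F nt.1 = set0.
  by have /nowhere_dense_cylP/(_ nt.2)[u ? ?] := nwdF nt.1; exists u.
(* The appended bit forces the lengths to grow, so the chain determines every coordinate of [x]. *)
pose t := fix t n : bstr := if n is m.+1 then rcons (ext (m, t m)) false else s.
have ext_t n : prefix (ext (n, t n)) (t n.+1) by exact: prefix_rcons.
have tS n : prefix (t n) (t n.+1).
  by apply: prefix_trans (ext_t n); case: (extP (n, t n)).
have t_le m n : (m <= n)%N -> prefix (t m) (t n).
  move=> /subnK <-; elim: (n - m)%N => [|k IH]; first exact: prefix_refl.
  exact: prefix_trans IH (tS _).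
have size_t n : (n <= size (t n))%N.
  elim: n => // n IH; rewrite /= size_rcons ltnS (leq_trans IH) //.
  by apply: size_prefix; case: (extP (n, t n)).
pose x : cantor_space := fun i => nth false (t i.+1) i.
have tx n : cyl (t n) x.
  move=> i ilt; rewrite /x.
  have [/t_le|/ltnW/t_le] := leqP n i.+1; last first.
    by move=> /sub_cyl/(_ _ (@cyl_zero_ext _))/(_ i (size_t _)).
  by move=> /sub_cyl/(_ _ (@cyl_zero_ext _))/(_ i ilt).
have : cyl s x by exact: (tx 0).
rewrite sF => -[n _ Fx].
have [_ /= extF] := extP (n, t n).
have : (cyl (ext (n, t n)) `&` F n) x.
  by split=> //; apply: sub_cyl (tx n.+1); exact: ext_t.
by rewrite extF.
Qed.

(** * Meager sets and the Baire property of Borel sets *)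

Lemma meager_bigcup (T : topologicalType) (F : nat -> set T) :
  (forall n, meager (F n)) -> meager (\bigcup_n F n).
Proof.
move=> mF; have /choice[G GP] n : exists G : nat -> set T,
    (forall k, nowhere_dense (G k)) /\ F n = \bigcup_k G k.
  by have [G ? ?] := mF n; exists G.
exists (fun m => if unpickle m is Some (n, k) then G n k else set0) => [m|].
  case: unpickle => [[n k]|]; first exact: (GP n).1.
  by rewrite /nowhere_dense closure0 interior0.
apply/seteqP; split=> [x [n _]|x [m _]].
  by rewrite (GP n).2 => -[k _ Gx]; exists (pickle (n, k)); rewrite ?pickleK.
case: unpickle => [[n k]|//] Gx; exists n => //.
by rewrite (GP n).2; exists k.
Qed.

Definition enum_bstr (n : nat) : bstr := odflt [::] (unpickle n).

Lemma enum_bstrK s : enum_bstr (pickle s) = s.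
Proof. by rewrite /enum_bstr pickleK. Qed.

(** There are only countably many strings, so the part of [B] inside the cylinders where it is
    meager is meager. What remains lies in [W], the complement of a dense open set. *)
Lemma meager_local (B : set cantor_space) :
  (forall s, exists2 t, prefix s t & meager (cyl t `&` B)) -> meager B.
Proof.
move=> h.
pose m n := if `[< meager (cyl (enum_bstr n) `&` B) >]
            then cyl (enum_bstr n) `&` B else set0.
pose W := ~` \bigcup_(t in [set t | meager (cyl t `&` B)]) cyl t.
apply: (@sub_meager _ _ (W `|` \bigcup_n m n)); last first.
  apply: meagerU; last first.
    apply: meager_bigcup => n; rewrite /m; case: ifPn => [/asboolP //|_].
    exact: meager0.
  exists (fun=> W); last by rewrite bigcup_const //; exists 0%N.
  move=> _; apply/nowhere_dense_cylP => s; have [t st mt] := h s.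
  by exists t => //; apply/seteqP; split=> // x [tx]; apply; exists t.
move=> x Bx; have [Wx|/contrapT[t mt tx]] := pselect (W x); first by left.
right; exists (pickle t) => //.
by rewrite /m enum_bstrK; case: ifPn => // /asboolPn; elim.
Qed.

(** A form of the Baire property: the sets satisfying the conclusion for every [s] form a
    sigma-algebra that contains the open sets. *)
Lemma borel_decided (B : set cantor_space) s : borel_pred B ->
  exists2 t, prefix s t & meager (cyl t `\` B) \/ meager (cyl t `&` B).
Proof.
move=> /asboolP.
pose G := [set B : set cantor_space | forall s, exists2 t, prefix s t &
  meager (cyl t `\` B) \/ meager (cyl t `&` B)].
have GP : sigma_algebra setT G.
  split=> [u|A GA u|A GA u].
  - by exists u; [exact: prefix_refl|right; rewrite setI0; exact: meager0].
  - have [t ut tA] := GA u; exists t => //; rewrite setTD setDE setCK.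
    by rewrite -setDE; case: tA; [right|left].
  (* If some [A n] is comeager in a cylinder below [u], so is the union. If not, each [A n] is
     locally meager in [cyl u], hence meager there, and so is the union. *)
  - have [[t [n [ut tA]]]|no] :=
      pselect (exists t n, prefix u t /\ meager (cyl t `\` A n)).
      exists t => //; left; apply: sub_meager tA.
      by apply: setDS; exact: bigcup_sup.
    exists u; first exact: prefix_refl.
    right; rewrite setI_bigcupr; apply: meager_bigcup => n.
    apply: meager_local => v.
    have [[x [ux vx]]|nuv] := pselect (cyl u `&` cyl v !=set0); last first.
      exists v; first exact: prefix_refl.
      apply: sub_meager (meager0 _) => x [vx [ux _]].
      by apply: nuv; exists x.
    have [w [uw vw _]] := cyl_compat ux vx; have [t wt tA] := GA n w.
    exists t; first exact: prefix_trans vw wt.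
    case: tA => tA; last by apply: sub_meager tA => y [ty [_ Ay]].
    by case: no; exists t, n; split=> //; exact: prefix_trans uw wt.
have openG : @open cantor_space `<=` G.
  move=> O oO u; have [[x [ux Ox]]|no] := pselect (cyl u `&` O !=set0).
    have /nbhs_sub_cyl[n nO] : nbhs x O by exact: open_nbhs_nbhs.
    have [t [ut nt tx]] := cyl_compat ux (@cyl_mkseq x n).
    exists t => //; left; apply: sub_meager (meager0 _) => y [ty] /=; apply.
    exact/nO/(sub_cyl nt).
  exists u; first exact: prefix_refl.
  by right; apply: sub_meager (meager0 _) => y ?; apply: no; exists y.
by move=> sB; exact: (smallest_sub GP openG sB).
Qed.

Lemma nonmeager_cyl (B : set cantor_space) : borel_pred B -> ~ meager B ->
  exists t, meager (cyl t `\` B).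
Proof.
move=> bB nB; apply: contrapT => no; apply: nB; apply: meager_local => s.
by have [t st [tB|tB]] := borel_decided s bB; [case: no; exists t|exists t].
Qed.

Local Open Scope order_scope.

(** * Order and disjointness in quotient algebras *)

Section quotient_facts.
Context d (A : ctbDistrLatticeType d) (I : ideal A).
Local Notation pi := (\pi_(ba_quot I))%qT.

Lemma pi_eq0 (a : A) : pi a = \bot <-> ideal_set I a.
Proof.
have -> : (pi a = \bot) <-> (pi a <= pi \bot).
  by split=> [->|h]; [exact: lexx|apply/eqP; rewrite -lex0].
by rewrite quot_pi_le diffx0.
Qed.

Lemma pi_meet (a b : A) : pi a `&` pi b = pi (a `&` b).
Proof. exact: quot_meetE. Qed.

End quotient_facts.

Section power_mod_fin.
Context d (A : ctbDistrLatticeType d).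
Local Notation pi := (\pi_(ba_quot (power_fin_ideal A)))%qT.
Implicit Types f g : ba_power A.

Lemma power_mod_fin_eq0 f : pi f = \bot <-> finite_set [set n | f n != \bot].
Proof.
rewrite pi_eq0 /= /power_fin /=.
by under eq_set do rewrite lt0x.
Qed.

Lemma power_mod_fin_le f g :
  pi f <= pi g <-> finite_set [set n | ~~ (f n <= g n)].
Proof.
rewrite quot_pi_le /= /power_fin /=.
have -> : [set n | \bot < (f `\` g) n] = [set n | ~~ (f n <= g n)] => //.
apply/seteqP; split=> n /=; rewrite lt0x diffE -[(f `&` _) n]/(f n `&` ~` g n);
  by rewrite -diffE diff_eq0.
Qed.

Lemma power_mod_fin_disj f g :
  pi f `&` pi g = \bot <-> finite_set [set n | f n `&` g n != \bot].
Proof. by rewrite pi_meet power_mod_fin_eq0. Qed.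

End power_mod_fin.

(** * Cylinder classes in the Cohen algebra *)

Lemma borel_pred_open (T : topologicalType) (O : set T) : open O -> borel_pred O.
Proof. by move=> oO; apply/asboolP; exact: sub_sigma_algebra. Qed.

Definition cohen_class (B : set cantor_space) (bB : borel_pred B) :
    cohen_algebra :=
  (\pi_(ba_quot (borel_meager_ideal cantor_space)) (mk_borel bB))%qT.

Definition cohen_cyl (s : bstr) : cohen_algebra :=
  cohen_class (borel_pred_open (@cyl_open s)).

Lemma cohen_class_ind (P : cohen_algebra -> Prop) :
  (forall B (bB : borel_pred B), P (cohen_class bB)) -> forall c, P c.
Proof. by move=> h; apply: quot_ind => -[B bB]; exact: h. Qed.

Lemma cohen_class_eq0 B (bB : borel_pred B) :
  cohen_class bB = \bot <-> meager B.
Proof. exact: (pi_eq0 (borel_meager_ideal cantor_space)). Qed.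

Lemma cohen_class_le B C (bB : borel_pred B) (bC : borel_pred C) :
  cohen_class bB <= cohen_class bC <-> meager (B `\` C)%classic.
Proof.
rewrite (quot_pi_le (borel_meager_ideal cantor_space)).
rewrite -[ideal_set _ _]/(meager (val (mk_borel bB `\` mk_borel bC))).
by rewrite diffE setDE.
Qed.

Lemma cohen_class_disj B C (bB : borel_pred B) (bC : borel_pred C) :
  cohen_class bB `&` cohen_class bC = \bot <-> meager (B `&` C)%classic.
Proof.
by rewrite (pi_meet (borel_meager_ideal cantor_space)) pi_eq0.
Qed.

Lemma cohen_cyl_neq0 s : cohen_cyl s != \bot.
Proof. by apply/eqP => /cohen_class_eq0; exact: cyl_not_meager. Qed.

Lemma cohen_cyl_prefix s t : prefix s t -> cohen_cyl t <= cohen_cyl s.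
Proof.
move=> /sub_cyl ts; apply/cohen_class_le; apply: sub_meager (meager0 _).
by move=> x [/ts].
Qed.

Lemma cohen_cyl_below c : c != \bot -> exists t, cohen_cyl t <= c.
Proof.
elim/cohen_class_ind: c => B bB /eqP nB.
have [|t tB] := nonmeager_cyl bB; first by move=> /(cohen_class_eq0 bB).
by exists t; apply/cohen_class_le.
Qed.

(** * Strings deciding an element of the Cohen algebra *)

Definition decides (s : bstr) (c : cohen_algebra) : Prop :=
  cohen_cyl s <= c \/ cohen_cyl s `&` c = \bot.

Lemma decides_prefix s t c : prefix s t -> decides s c -> decides t c.
Proof.
move=> /cohen_cyl_prefix ts [sc|sc]; [left; exact: le_trans ts sc|right].
by apply/eqP; rewrite -lex0 -sc leI2.
Qed.

Lemma decides_dense s c : exists2 t, prefix s t & decides t c.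
Proof.
elim/cohen_class_ind: c => B bB.
have [t st [tB|tB]] := borel_decided s bB; exists t => //.
  by left; apply/cohen_class_le.
by right; apply/cohen_class_disj.
Qed.

(** A string [t] below [a] in [A] has both [rcons a true] and [rcons a false] as extensions; the
    cylinder of the first lies in [U], that of the second misses it because [A] is an antichain. *)
Lemma nowhere_dense_undecided (N : set bstr_space) : nowhere_dense N ->
  exists c, forall t, N t -> ~ decides t c.
Proof.
move=> /nowhere_dense_bstrP[A [antiA _] NA].
pose U := (\bigcup_(a in A) cyl (rcons a true))%classic.
have oU : open U by apply: bigcup_open => a _; exact: cyl_open.
exists (cohen_class (borel_pred_open oU)) => t /NA[a Aa ta].
have ext b : prefix t (rcons a b) by exact: prefix_trans ta (prefix_rcons _ _).
have a1 : cohen_cyl (rcons a true) <= cohen_class (borel_pred_open oU).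
  apply/cohen_class_le; apply: sub_meager (meager0 _) => x [ax].
  by apply; exists a.
have a0 : cohen_cyl (rcons a false) `&` cohen_class (borel_pred_open oU) = \bot.
  apply/cohen_class_disj; apply: sub_meager (meager0 _) => x [ax [b Ab bx]].
  have pa : cyl a x by apply: sub_cyl ax; exact: prefix_rcons.
  have pb : cyl b x by apply: sub_cyl bx; exact: prefix_rcons.
  have ab : a = b.
    have [ab|/ltnW ba] := leqP (size a) (size b).
      by apply: antiA => //; exact: cyl_prefix pa pb ab.
    by apply/esym; apply: antiA => //; exact: cyl_prefix pb pa ba.
  (* With [a = b], the two cylinders prescribe opposite bits at position [size a]. *)
  have := ax (size a); have := bx (size a).
  by rewrite -ab !size_rcons !nth_rcons ltnn eqxx leqnn => -> // /(_ isT).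
case=> tc.
  have := le_trans (cohen_cyl_prefix (ext false)) tc.
  by rewrite leEmeet a0 eq_sym; apply/negP; exact: cohen_cyl_neq0.
have := cohen_cyl_neq0 (rcons a true); rewrite -lex0 -tc lexI a1 andbT.
by rewrite cohen_cyl_prefix.
Qed.

(** * Left inequality: dense sets of strings from nonzero classes of sequences *)

Section dense_le_reaping.

Let shifts (N : set bstr_space) k : set bstr_space :=
  [set t : bstr | exists2 j, (j < k)%N & N (enum_bstr j ++ t)].

(** The finitely many shifts are avoided one after the other, extending the string each time. *)
Lemma nowhere_dense_shifts N k : nowhere_dense N -> nowhere_dense (shifts N k).
Proof.
move=> /nowhere_dense_extP nwdN; apply/nowhere_dense_extP.
elim: k => [|k IH] s; first by exists s; [exact: prefix_refl|move=> u _ []].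
have [t st tN] := IH s; have [w /prefixP[v ->] wN] := nwdN (enum_bstr k ++ t).
exists (t ++ v); first exact: prefix_trans st (prefix_prefix _ _).
move=> u tu [j]; rewrite ltnS leq_eqVlt => /predU1P[->|jk] Nu.
  apply: wN Nu; case/prefixP: tu => x ->.
  by rewrite !catA prefix_prefix.
by apply: (tN u); [exact: prefix_trans (prefix_prefix _ _) tu|exists j].
Qed.

Lemma dense_le_reaping_cohen :
  tukey_le dense_sys (reaping_sys cohen_power_mod_Fin).
Proof.
have /choice[b bP] (Nk : {N : set bstr_space | nowhere_dense N} * nat) :
    exists c, forall t, shifts (sval Nk.1) Nk.2 t -> ~ decides t c.
  exact/nowhere_dense_undecided/nowhere_dense_shifts/svalP.
have /choice[t tP] (c : cohen_algebra) :
    exists t, c != \bot -> cohen_cyl t <= c.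
  have [->|/cohen_cyl_below[t tc]] := eqVneq c \bot; first by exists [::].
  by exists t.
pose phm (N : {N : set bstr_space | nowhere_dense N}) : cohen_power_mod_Fin :=
  (\pi_(ba_quot (power_fin_ideal cohen_algebra)) (fun k => b (N, k)))%qT.
pose D (r : cohen_power_mod_Fin) : set bstr_space :=
  (\bigcup_(k in [set k | repr r k != \bot])
    [set (enum_bstr j ++ t (repr r k) : bstr) | j in `I_k])%classic.
have dD (r : {r : cohen_power_mod_Fin | r != \bot}) : dense (D (val r)).
  apply/dense_bstrP => s; case: r => r /= r0.
  (* A nonzero class has infinitely many nonzero coordinates; one beyond [pickle s] makes [s] an
     admissible prefix in [D r]. *)
  have [k [rk sk]] : exists k, repr r k != \bot /\ (pickle s < k)%N.
    apply: contrapT => no; move/negP: r0; apply; rewrite -[r]reprK; apply/eqP.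
    apply/power_mod_fin_eq0; apply: sub_finite_set (finite_II (pickle s).+1).
    move=> k /= rk; rewrite ltnS leqNgt; apply/negP => sk.
    by apply: no; exists k.
  exists (s ++ t (repr r k)); first exact: prefix_prefix.
  by exists k => //; exists (pickle s) => //; rewrite enum_bstrK.
exists phm, (fun r => exist _ (D (val r)) (dD r)) => N r Nr /=.
(* For almost all [k], [repr (val r) k] is below or disjoint from [b (N, k)], and the cylinder class
   of the chosen string inherits this. *)
have fin : finite_set [set k | repr (val r) k != \bot /\
                               ~ decides (t (repr (val r) k)) (b (N, k))].
  case: Nr => /=; rewrite -{1}[val r]reprK /phm.
    move=> /power_mod_fin_le; apply: sub_finite_set => k /= [rk].
    apply: contra_notN => rb; left.
    by apply: le_trans rb; exact: tP.
  move=> /power_mod_fin_disj; apply: sub_finite_set => k /= [rk].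
  apply: contra_notN => /eqP rb; right.
  by apply/eqP; rewrite -lex0 -rb leI2 //; exact: tP.
(* An element of [N] contributed to [D (val r)] by [k] puts [t (repr (val r) k)] into
   [shifts (sval N) k], so it does not decide [b (N, k)] and [k] is among the finitely many
   exceptions; each [k] contributes at most [k] strings. *)
apply: sub_finite_set (bigcup_finite fin
  (fun k _ => finite_image
    (fun j => enum_bstr j ++ t (repr (val r) k) : bstr) (finite_II k))).
move=> u [Nu [k rk [j jk ju]]]; exists k; last by exists j.
by split=> //; apply: (bP (N, k)); exists j => //; rewrite ju.
Qed.

End dense_le_reaping.

(** * Right inequality: reaping by a dense set and an infinite set of indices *)

Section reaping_le_seq.

Let tail (s : bstr) : bstr := drop (index true s).+1 s.

Let index_cat_true (s u : bstr) :
  true \in s -> index true (s ++ u) = index true s.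
Proof. by move=> s1; rewrite index_cat s1. Qed.

Let tail_cat s u : true \in s -> tail (s ++ u) = tail s ++ u.
Proof.
move=> s1; rewrite /tail index_cat_true // drop_cat.
case: ltngtP => // [|->]; first by rewrite ltnS leqNgt index_mem s1.
by rewrite subnn drop0 drop_size.
Qed.

Let undecided (f : nat -> cohen_algebra) : set bstr_space :=
  [set s : bstr | true \in s /\ ~ decides (tail s) (f (index true s))].

(** Appending [true] to [s] fixes the position of the first [true], hence the coordinate of [f] in
    question. Once the tail is extended to decide that coordinate, all further extensions decide it
    too. *)
Lemma nowhere_dense_undecided_tail f : nowhere_dense (undecided f).
Proof.
apply/nowhere_dense_extP => s; pose s1 := rcons s true.
have s1P : true \in s1 by rewrite mem_rcons mem_head.
have [t /prefixP[u ->] dt] := decides_dense (tail s1) (f (index true s1)).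
exists (s1 ++ u).
  exact: prefix_trans (prefix_rcons _ _) (prefix_prefix _ _).
move=> w /prefixP[v ->]; rewrite -catA => -[_]; apply.
rewrite tail_cat // index_cat_true //; apply: decides_prefix dt.
by rewrite catA prefix_prefix.
Qed.

Lemma reaping_cohen_le_seq : tukey_le (reaping_sys cohen_power_mod_Fin)
  (rs_seq dense_sys (reaping_sys Pomega_mod_fin)).
Proof.
have /choice[d dP] (D : {D : set bstr_space | dense D}) :
    exists d : nat -> bstr, forall n,
      [/\ sval D (d n), true \in d n & index true (d n) = n].
  suff /choice[d dP] : forall n, exists w : bstr,
      [/\ sval D w, true \in w & index true w = n] by exists d.
  move=> n; case: D => /= D /dense_bstrP/(_ (rcons (nseq n false) true)).
  have m1 : true \in rcons (nseq n false) true by rewrite mem_rcons mem_head.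
  move=> [w /prefixP[u ->] Dw]; exists (rcons (nseq n false) true ++ u).
  split=> //; first by rewrite mem_cat m1.
  rewrite index_cat_true // -cats1 index_cat mem_nseq andbF size_nseq.
  by rewrite /= addn0.
pose N (f : cohen_power_mod_Fin) : {N : set bstr_space | nowhere_dense N} :=
  exist _ (undecided (repr f)) (@nowhere_dense_undecided_tail (repr f)).
pose G (f : cohen_power_mod_Fin) (D : {D : set bstr_space | dense D})
    : set nat :=
  [set n | cohen_cyl (tail (d D n)) <= repr f n].
pose g f D : Pomega_mod_fin := (\pi_(ba_quot fin_ideal) (G f D))%qT.
pose r (D : {D : set bstr_space | dense D}) (X : set nat)
    : ba_power cohen_algebra :=
  fun n => if `[< X n >] then cohen_cyl (tail (d D n)) else \bot.
have r_neq0 (DX : {D : set bstr_space | dense D} *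
                  {X : Pomega_mod_fin | X != \bot}) :
    (\pi_(ba_quot (power_fin_ideal cohen_algebra))
      (r DX.1 (repr (val DX.2))))%qT != \bot.
  (* Cylinder classes are nonzero, so a zero class would make [repr X] finite. *)
  case: DX => D [X X0] /=; apply: contra_neq X0 => /power_mod_fin_eq0 fr.
  rewrite -[X]reprK; apply/pi_eq0; apply: sub_finite_set fr => n Xn /=.
  by rewrite /r asboolT //; exact: cohen_cyl_neq0.
exists (fun f => (N f, g f)).
exists (fun DX => exist (fun x : cohen_power_mod_Fin => x != \bot) _
                    (r_neq0 DX)) => f [D [X X0]] /= [finND fX].
have fin : finite_set [set n | ~ decides (tail (d D n)) (repr f n)].
  (* Since [index true] recovers [n] from [d D n], the exceptional [n] lie in the image of a finite
     set. *)
  apply: sub_finite_set (finite_image (index true) finND) => n /= nd.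
  have [Dd d1 dn] := dP D n.
  by exists (d D n) => //; split=> //; split=> //; rewrite dn.
(* If [X] is almost inside [G f D], the sequence is almost below [f]. If [X] is almost disjoint from
   [G f D], then at almost all [n] in [X] the string decides [repr f n] without being below it,
   which leaves disjointness. *)
case: fX => /= [|]; rewrite -{1}[X]reprK /g.
  move=> /quot_pi_le; rewrite diffE => finX; left.
  rewrite -[f]reprK; apply/power_mod_fin_le; apply: sub_finite_set finX.
  move=> n /=; rewrite /r; case: ifPn; last by rewrite le0x.
  by move=> /asboolP Xn /negP nG; split.
move=> /eqP; rewrite pi_meet => /eqP/pi_eq0 finX; right.
rewrite -[f]reprK; apply/power_mod_fin_disj.
apply: (@sub_finite_set _ _ ((repr X `&` G f D)%classic `|`
  [set n | ~ decides (tail (d D n)) (repr f n)])%classic); last first.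
  by rewrite finite_setU.
move=> n /=; rewrite /r; case: ifPn; last by rewrite meet0x eqxx.
move=> /asboolP Xn /eqP nd.
have [[sG|//]|ndec] := pselect (decides (tail (d D n)) (repr f n)).
  by left.
by right.
Qed.

End reaping_le_seq.

Theorem theorem4p8 :
  tukey_le dense_sys (reaping_sys cohen_power_mod_Fin) /\
  tukey_le (reaping_sys cohen_power_mod_Fin)
    (rs_seq dense_sys (reaping_sys Pomega_mod_fin)).
Proof. by split; [exact: dense_le_reaping_cohen|exact: reaping_cohen_le_seq]. Qed.
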